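(* Let $n\ge 3$ and $K\subseteq\{2,\ldots,n-1\}$. Then $\mathcal{D}(S_K)=F_K$.
   Context: $[n]=\{1,\ldots,n\}$. The generalised Fishburn domain $F_K$ is the set of all linear orders $v$ on $[n]$ such that for all $1\le i<j<k\le n$: if $j\in K$ then $j$ is not ranked last by $v$ among $\{i,j,k\}$, and if $j\notin K$ then $j$ is not ranked first by $v$ among $\{i,j,k\}$. Necklace $S_K$: let $L=\{2,\ldots,n-1\}\setminus K$, with elements $k_1<\cdots<k_s$ of $K$ and $\ell_1<\cdots<\ell_t$ of $L$. Place the numbers $1,\ldots,n$ (''beads'') on a circle in the cyclic order $1, k_1,\ldots,k_s, n, \ell_t,\ldots,\ell_1$ (then back to $1$); beads $1,k_1,\ldots,k_s,n$ are white and $\ell_1,\ldots,\ell_t$ are black. A set $X\subseteq[n]$ is $w$-convex if (1) $X$ is an arc (contiguous set) of this circle, (2) $X$ is not a single black bead, and (3) there are no integers $i<j<k$ with $i,k\in X$, $j\notin X$ and $j$ white. A flag of $w$-convex sets is a chain $X_1\subset X_2\subset\cdots\subset X_n=[n]$ of $w$-convex sets with $|X_k|=k$; it defines the linear order $x_1x_2\ldots x_n$ (ranked from top) where $\{x_i\}=X_i\setminus X_{i-1}$, $X_0=\emptyset$. $\mathcal{D}(S_K)$ is the set of all linear orders arising from flags of $w$-convex sets. *)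

(* Defs.v *)
From mathcomp Require Import all_boot all_fingroup.

Set Implicit Arguments.
Unset Strict Implicit.
Unset Printing Implicit Defensive.

(* The alternatives 1, ..., n are encoded as the elements of 'I_n, the ordinal
   of value i standing for the integer i + 1; all conditions below only use the
   order of the integers, the two extremes 1 and n having values 0 and n - 1. *)

(* A linear order on the alternatives is a permutation v of 'I_n read as the
   ranking v 0, v 1, ..., v (n - 1), from top to bottom. *)
Definition ranking (n : nat) := {perm 'I_n}.

Definition prefers n (v : ranking n) (x y : 'I_n) : bool :=
  (v^-1)%g x < (v^-1)%g y.

Definition ranked_first n (v : ranking n) (A : {set 'I_n}) (x : 'I_n) : bool :=
  (x \in A) && [forall y in A :\ x, prefers v x y].

Definition ranked_last n (v : ranking n) (A : {set 'I_n}) (x : 'I_n) : bool :=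
  (x \in A) && [forall y in A :\ x, prefers v y x].

Definition fishburn_domain n (K : {set 'I_n}) : {set ranking n} :=
  [set v : ranking n | [forall i : 'I_n, forall j : 'I_n, forall k : 'I_n,
    (i < j < k) ==>
      (if j \in K then ~~ ranked_last v [set i; j; k] j
       else ~~ ranked_first v [set i; j; k] j)]].

(* The sets {1}, {n} and {2, ..., n - 1} of integers. *)
Definition least_bead n : {set 'I_n} := [set i : 'I_n | i == 0 :> nat].
Definition greatest_bead n : {set 'I_n} := [set i : 'I_n | i.+1 == n].
Definition inner n : {set 'I_n} := [set i : 'I_n | (0 < i) && (i.+1 < n)].

Definition white n (K : {set 'I_n}) : {set 'I_n} :=
  least_bead n :|: K :|: greatest_bead n.
Definition black n (K : {set 'I_n}) : {set 'I_n} := inner n :\: K.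

(* The circle, cut open just before the bead 1. Over 'I_n, enum lists a set in
   increasing order. *)
Definition necklace n (K : {set 'I_n}) : seq 'I_n :=
  enum (least_bead n) ++ enum K ++ enum (greatest_bead n)
    ++ rev (enum (black K)).

Definition arc n (K X : {set 'I_n}) : bool :=
  [exists r : 'I_n, exists m : 'I_n.+1,
     X == [set x in take m (rot r (necklace K))]].

Definition w_convex n (K X : {set 'I_n}) : bool :=
  [&& arc K X,
      ~~ [exists b in black K, X == [set b]]
    & ~~ [exists i : 'I_n, exists j : 'I_n, exists k : 'I_n,
            [&& i < j < k, i \in X, k \in X, j \notin X & j \in white K]]].

(* X k is the k-th set of the chain, including X 0 = set0, which is not itself
   required to be w-convex. *)
Definition w_flag n (K : {set 'I_n}) (X : {ffun 'I_n.+1 -> {set 'I_n}}) : bool :=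
  [&& X ord0 == set0,
      X ord_max == [set: 'I_n],
      [forall k : 'I_n.+1, (0 < k) ==> w_convex K (X k) && (#|X k| == k)]
    & [forall j : 'I_n.+1, forall k : 'I_n.+1, (j < k) ==> (X j \proper X k)]].

Definition flag_ranking n (X : {ffun 'I_n.+1 -> {set 'I_n}}) (v : ranking n)
    : bool :=
  [forall i : 'I_n, [set v i] == X (inord i.+1) :\: X (inord i)].

Definition necklace_domain n (K : {set 'I_n}) : {set ranking n} :=
  [set v : ranking n |
    [exists X : {ffun 'I_n.+1 -> {set 'I_n}}, w_flag K X && flag_ranking X v]].

(* Main.v *)
Require Import Defs.
From mathcomp Require Import all_boot all_fingroup zify.

(* Both domains are described by the sets of top alternatives of an order. An
   order lies in F_K iff for all i < j < k each of its top sets X satisfies: if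
   j is white and i, k lie in X, then so does j (condition (3) of w-convexity);
   if j is black and i, k lie outside X, then so does j ("thinness"). A thin X
   satisfying (3) is an arc, by cases on which of 1 and n it contains, and not a
   single black bead. Conversely, an arc satisfying (3) which contains a white
   bead is thin: if it also contains a black j, it must go round 1 or n, so it
   contains all black beads lying between j and that extreme and, by (3), all the
   white ones, that is, all the integers on one side of j. Each nonempty top
   set of a flag does contain a white bead, since the first one is w-convex, hence
   not a single black bead. *)

(** * Arcs of a cyclic list as intervals of positions *)

(** The positions taken run cyclically from [r]; the second disjunct covers those reached after
    wrapping past the end of [s]. *)
Lemma mem_take_rot {T : eqType} {s : seq T} {x : T} (r m : nat) :
  uniq s -> x \in s -> r <= size s ->
  (x \in take m (rot r s)) =
    (r <= index x s < r + m) || (index x s + size s < r + m).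
Proof.
move=> us xs rs; rewrite in_take ?mem_rot // /rot index_cat size_drop.
have -> : index x s = if x \in take r s then index x (take r s)
                      else r + index x (drop r s).
  by rewrite -{1}(cat_take_drop r s) index_cat size_takel.
have := us; rewrite -{1}(cat_take_drop r s) cat_uniq => /and3P[_ /hasPn dis _].
have := xs; rewrite -{1}(cat_take_drop r s) mem_cat.
have ia : (index x (take r s) < r) = (x \in take r s).
  by rewrite -{2}(size_takel rs) index_mem.
have ib : (index x (drop r s) < size s - r) = (x \in drop r s).
  by rewrite -size_drop index_mem.
case: (boolP (x \in drop r s)) (dis x) ib => [_ /(_ isT) /negbTE /= -> |_ _].
  by move=> ? _; lia.
by rewrite orbF => ? xa; rewrite xa in ia *; lia.
Qed.

Definition order_convex {T : finType} (f : T -> nat) (X : {set T}) : Prop :=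
  forall x y z, f x <= f y <= f z -> x \in X -> z \in X -> y \in X.

Lemma order_convex_interval {T : finType} (f : T -> nat) (N : nat) (X : {set T}) :
  (forall x, f x < N) -> order_convex f X ->
  exists p q, p <= q <= N /\ forall x, (x \in X) = (p <= f x < q).
Proof.
move=> fN cX; have [->|[x0 x0X]] := set_0Vmem X.
  by exists 0, 0; split=> // x; rewrite inE; lia.
case: (arg_minnP f x0X) => a aX amin; case: (arg_maxnP f x0X) => b bX bmax.
exists (f a), (f b).+1; split.
  by have := fN b; have := bmax a aX; move=> /=; lia.
move=> x; apply/idP/idP => [xX|fx].
  by have := amin x xX; have := bmax x xX; move=> /=; lia.
by apply: (cX a x b) => //; lia.
Qed.

(* An arc of the circle is an interval of the circle cut open, or the complement
   of one. *)
Lemma rot_arcP {T : finType} (s : seq T) (X : {set T}) :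
  uniq s -> (forall x, x \in s) -> 0 < size s ->
  (exists r m, [/\ r < size s, m <= size s & X = [set x in take m (rot r s)]])
  <-> order_convex (index^~ s) X \/ order_convex (index^~ s) (~: X).
Proof.
move=> us sT s0; have ix x : index x s < size s by rewrite index_mem.
split=> [[r [m [rs ms ->]]]|].
  have [rm|rm] := leqP (r + m) (size s); [left|right] => x y z;
  have := ix x; have := ix y; have := ix z;
  rewrite !inE !(mem_take_rot r m us (sT _) (ltnW rs)) => /=; lia.
case=> /(order_convex_interval _ _ _ ix) [p [q [pq Xpq]]].
  have [ps|ps] := ltnP p (size s).
    exists p, (q - p); split; [lia|lia|apply/setP=> x].
    rewrite inE Xpq (mem_take_rot p _ us (sT _) (ltnW ps)).
    by have := ix x; rewrite /=; lia.
  (* Here [p = q = size s], so [X] is empty, and the start must be moved to a position below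
     [size s]. *)
  exists 0, 0; split; [lia|lia|apply/setP=> x].
  by rewrite inE Xpq take0 in_nil; have := ix x; rewrite /=; lia.
have {}Xpq x : (x \in X) = ~~ (p <= index x s < q) by rewrite -Xpq inE negbK.
have [qs|qs] := ltnP q (size s).
  (* The complement of the positions from [p] to [q - 1] is read cyclically, starting at [q] and
     wrapping round up to [p]. *)
  exists q, (size s - (q - p)); split; [lia|lia|apply/setP=> x].
  rewrite inE Xpq (mem_take_rot q _ us (sT _) (ltnW qs)).
  by have := ix x; rewrite /=; lia.
exists 0, p; split; [lia|lia|apply/setP=> x].
rewrite inE Xpq (mem_take_rot 0 _ us (sT _) (leq0n _)).
by have := ix x; rewrite /=; lia.
Qed.

Lemma ltn_index_sorted_key {T : eqType} (f : T -> nat) (s : seq T) (x y : T) :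
  sorted (relpre f ltn) s -> x \in s -> y \in s ->
  (index x s < index y s) = (f x < f y).
Proof.
move=> ss xs ys; have tr : transitive (relpre f ltn).
  by move=> a b c /=; apply: ltn_trans.
apply/idP/idP; first exact: (sorted_ltn_index tr ss).
apply: contraTT; rewrite -leqNgt leq_eqVlt => /orP[/eqP e|].
  by rewrite -(nth_index x ys) e nth_index // ltnn.
by move/(sorted_ltn_index tr ss _ _ ys xs) => /= h; rewrite -leqNgt ltnW.
Qed.

Lemma enum_ord_sorted {n : nat} (A : {set 'I_n}) :
  pairwise (relpre (@nat_of_ord n) ltn) (enum A).
Proof.
rewrite {1}/enum_mem -enumT; apply: pairwise_filter.
by rewrite -pairwise_map val_enum_ord -(sorted_pairwise ltn_trans) iota_ltn_sorted.
Qed.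

(* Strictly increasing along the necklace, the black beads, which come last in
   decreasing order, being reflected above the white ones. *)
Definition bead_key {n : nat} (K : {set 'I_n}) (x : 'I_n) : nat :=
  if x \in black K then n + n - x else x.

(** Testing [j \in K] amounts to testing that [j] is white, because a [j] strictly between two beads
    is neither extreme. *)
Definition white_convex {n : nat} (K X : {set 'I_n}) : Prop :=
  forall i j k : 'I_n, i < j < k -> j \in K -> i \in X -> k \in X -> j \in X.

(** This is the dual of [white_convex], with [K] and [X] both replaced by their complements. *)
Definition black_thin {n : nat} (K X : {set 'I_n}) : Prop :=
  forall i j k : 'I_n, i < j < k -> j \notin K -> i \notin X -> k \notin X ->
  j \notin X.

(** * Convex sets on the necklace *)

Section Necklace.

Context {n : nat} {K : {set 'I_n}}.

Lemma blackE x : (x \in black K) = [&& x \notin K, 0 < x & x.+1 < n].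
Proof. by rewrite !inE. Qed.

Lemma bead_key_le x y :
  (bead_key K x <= bead_key K y) =
  if x \in black K then (y \in black K) && (y <= x)
  else (y \in black K) || (x <= y).
Proof.
rewrite /bead_key; have := ltn_ord x; have := ltn_ord y.
by case: (x \in black K); case: (y \in black K) => /=; lia.
Qed.

Lemma inner_between (i j k : 'I_n) : i < j < k -> (0 < j) && (j.+1 < n).
Proof. by have := ltn_ord k; lia. Qed.

Lemma black_between (i j k : 'I_n) : i < j < k -> (j \in black K) = (j \notin K).
Proof. by move=> /inner_between jn; rewrite blackE jn andbT. Qed.

(** Weak inequalities allow [i] or [k] to be an extreme bead without a separate check that it
    differs from [j]. *)
Lemma white_convex_le X (i j k : 'I_n) :
  white_convex K X -> j \notin black K -> i <= j <= k -> i \in X -> k \in X ->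
  j \in X.
Proof.
move=> wX jw /andP[ij jk] iX kX.
have [e|ne] := eqVneq i j; first by rewrite -e.
have [e|ne'] := eqVneq k j; first by rewrite -e.
have ijk : i < j < k by move: ne ne'; rewrite -!val_eqE /=; lia.
apply: (wX i j k) => //; move: jw.
by rewrite (black_between _ _ _ ijk) negbK.
Qed.

Lemma black_thin_le X (i j k : 'I_n) :
  black_thin K X -> j \in black K -> i <= j <= k -> i \notin X -> k \notin X ->
  j \notin X.
Proof.
move=> bX jb /andP[ij jk] iX kX.
have [e|ne] := eqVneq i j; first by rewrite -e.
have [e|ne'] := eqVneq k j; first by rewrite -e.
have ijk : i < j < k by move: ne ne'; rewrite -!val_eqE /=; lia.
by apply: (bX i j k) => //; rewrite -(black_between _ _ _ ijk).
Qed.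

Hypotheses (hn : 3 <= n) (hK : K \subset inner n).

Lemma whiteE x : (x \in white K) = (x \notin black K).
Proof.
have := subsetP hK x; have := ltn_ord x; rewrite !inE.
case: (x \in K) => /=; last by lia.
by move=> _ /(_ isT); lia.
Qed.

Lemma necklace_sorted : sorted (relpre (bead_key K) ltn) (necklace K).
Proof.
apply: pairwise_sorted; rewrite /necklace.
have inK x : x \in K -> (0 < x) && (x.+1 < n).
  by move/(subsetP hK); rewrite inE.
have kw (A : {set 'I_n}) : {in A, forall x, x \notin black K} ->
    pairwise (relpre (bead_key K) ltn) (enum A).
  move=> hA; apply: sub_in_pairwise (enum_ord_sorted A); last first.
    by apply/allP => x; rewrite mem_enum; exact: id.
  move=> x y xA yA /=.
  by rewrite /bead_key (negbTE (hA x xA)) (negbTE (hA y yA)).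
rewrite !pairwise_cat; apply/and5P; split.
- apply/allrelP=> x y; rewrite !mem_cat mem_rev !mem_enum /= /bead_key !blackE.
  rewrite !inE => /eqP x0; have := inK y; have := ltn_ord y.
  by case: (y \in K); case: (x \in K); rewrite /=; do ?case: ifP; lia.
- apply: kw => x; rewrite blackE inE; lia.
- apply/allrelP=> x y; rewrite !mem_cat mem_rev !mem_enum /= /bead_key !blackE.
  rewrite !inE => xK; rewrite xK; have := ltn_ord y; have := inK x xK.
  by case: (y \in K) => /=; do ?case: ifP; lia.
- by apply: kw => x; rewrite blackE => ->.
- apply/and3P; split.
  + apply/allrelP=> x y; rewrite mem_rev !mem_enum /= /bead_key blackE => + yb.
    by rewrite yb inE; have := ltn_ord y; have := ltn_ord x; case: ifP; lia.
  + by apply: kw => x; rewrite blackE inE; lia.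
  + have tr : transitive (relpre (bead_key K) ltn) by move=> a b c /=; apply: ltn_trans.
    (* After reversal the goal is that the key decreases while the black beads increase. *)
    rewrite -(sorted_pairwise tr) rev_sorted sorted_pairwise; last first.
      by move=> a b c /= h1 h2; apply: ltn_trans h2 h1.
    apply: sub_in_pairwise (enum_ord_sorted (black K)); last first.
      by apply/allP => x; rewrite mem_enum; exact: id.
    move=> x y xA yA /=; rewrite /bead_key.
    by have := ltn_ord x; have := ltn_ord y; rewrite xA yA; lia.
Qed.

Lemma mem_necklace x : x \in necklace K.
Proof.
rewrite !mem_cat mem_rev !mem_enum blackE !inE.
by have := ltn_ord x; case: (x \in K) => /=; lia.
Qed.

(** The necklace is strictly sorted by [bead_key], so positions and keys order the beads alike, and
    [rot_arcP] can be read in terms of keys. *)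
Lemma arc_bead_keyP X :
  Defs.arc K X <-> order_convex (bead_key K) X \/ order_convex (bead_key K) (~: X).
Proof.
have tr : transitive (relpre (bead_key K) ltn) by move=> a b c /=; apply: ltn_trans.
have un : uniq (necklace K).
  by apply: sorted_uniq tr _ _ necklace_sorted => x /=; rewrite ltnn.
have sz : size (necklace K) = n.
  have := card_uniqP un; rewrite (eq_card (B := 'I_n)) ?card_ord // => x.
  by rewrite mem_necklace.
have le x y : (index x (necklace K) <= index y (necklace K)) =
              (bead_key K x <= bead_key K y).
  rewrite leqNgt (ltn_index_sorted_key _ _ _ _ necklace_sorted).
  - by rewrite -leqNgt.
  - exact: mem_necklace.
  - exact: mem_necklace.
have cE Y : order_convex (index^~ (necklace K)) Y <-> order_convex (bead_key K) Y.
  by split=> cY x y z; have := cY x y z; rewrite /= !le.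
rewrite -!cE -rot_arcP //; last 2 first.
- exact: mem_necklace.
- by rewrite sz; lia.
rewrite sz; split=> [/existsP[r /existsP[m /eqP ->]]|[r [m [rn mn ->]]]].
  by exists r, m; split => //; have := ltn_ord m; have := ltn_ord r => /=; lia.
apply/existsP; exists (Ordinal rn); apply/existsP.
by exists (Ordinal (mn : m < n.+1)).
Qed.

Lemma w_convexP X :
  w_convex K X <->
  [/\ order_convex (bead_key K) X \/ order_convex (bead_key K) (~: X),
      forall b, b \in black K -> X <> [set b] & white_convex K X].
Proof.
split=> [/and3P[/arc_bead_keyP aX bX wX]|[/arc_bead_keyP aX bX wX]].
  split=> // [b bK e|i j k ijk jK iX kX].
    by case/negP: bX; apply/existsP; exists b; rewrite bK e /=.
  apply: contraNT wX => jX; apply/existsP; exists i; apply/existsP; exists j.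
  apply/existsP; exists k.
  by rewrite ijk iX kX jX whiteE (black_between _ _ _ ijk) jK.
rewrite /w_convex aX /=; apply/andP; split; apply/negP.
  by case/existsP => b /andP[bK /eqP]; apply: bX.
case/existsP=> i /existsP[j /existsP[k /and5P[ijk iX kX jX]]].
rewrite whiteE (black_between _ _ _ ijk) negbK => jK.
by rewrite (wX i j k) in jX.
Qed.

Lemma least_lt : 0 < n. Proof. by lia. Qed.
Lemma greatest_lt : n.-1 < n. Proof. by lia. Qed.

Let least : 'I_n := Ordinal least_lt.
Let greatest : 'I_n := Ordinal greatest_lt.

Lemma least_white : least \notin black K.
Proof. by rewrite blackE /= andbF. Qed.

Lemma greatest_white : greatest \notin black K.
Proof. by rewrite blackE /=; apply/negP=> /and3P[_ _]; lia. Qed.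

Lemma least_le (x : 'I_n) : least <= x. Proof. by []. Qed.
Lemma le_greatest (x : 'I_n) : x <= greatest.
Proof. by have := ltn_ord x => /=; lia. Qed.

Lemma convex_thin_arc X :
  white_convex K X -> black_thin K X ->
  order_convex (bead_key K) X \/ order_convex (bead_key K) (~: X).
Proof.
move=> wX bX.
have W i j k := @white_convex_le X i j k wX.
have B i j k := @black_thin_le X i j k bX.
have lo := least_le; have hi := le_greatest.
have [oX|oX] := boolP (least \in X); have [mX|mX] := boolP (greatest \in X).
(* Both extremes are in [X], hence so are all white beads; the complement is black, and an interval
   there by thinness. *)
- right=> x y z; rewrite !inE !bead_key_le => le xX zX.
  have [xb|xw] := boolP (x \in black K); last first.
    by rewrite (W least x greatest) ?lo ?hi in xX.
  rewrite xb in le; have [yb|] := boolP (y \in black K); last by lia.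
  by rewrite yb in le; apply: (B z y x) => //; lia.
(* Only [least] is in [X]: outside [X], the white beads and the black beads are each closed upwards,
   so the complement is an arc around [greatest]. *)
- right=> x y z; rewrite !inE !bead_key_le => le xX zX.
  have [yb|yw] := boolP (y \in black K).
    by rewrite yb in le; apply: (B z y greatest) => //; rewrite hi; lia.
  have xw : x \notin black K by move: le; rewrite (negbTE yw); case: ifP.
  apply: contra xX => yX; apply: (W least x y) => //; rewrite lo.
  by rewrite (negbTE xw) (negbTE yw) in le; lia.
(* Only [greatest] is in [X]: now the white beads and the black beads of [X] are each closed
   upwards. *)
- left=> x y z; rewrite !bead_key_le => le xX zX.
  have [yb|yw] := boolP (y \in black K).
    rewrite yb in le; apply: contraLR zX => yX.
    by apply: (B least z y) => //; [case/andP: le=> _ /andP[]|rewrite lo; lia].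
  have xw : x \notin black K by move: le; rewrite (negbTE yw); case: ifP.
  apply: (W x y greatest) => //; rewrite hi.
  by rewrite (negbTE xw) (negbTE yw) in le; lia.
(* Neither extreme is in [X]: by thinness [X] has no black bead, and it is an interval of white
   ones. *)
- left=> x y z; rewrite !bead_key_le => le xX zX.
  have Xw t : t \in X -> t \notin black K.
    by apply: contraL => tb; apply: (B least t greatest); rewrite ?lo ?hi.
  rewrite (negbTE (Xw _ zX)) (negbTE (Xw _ xX)) in le.
  have [yb|yw] := boolP (y \in black K); first by rewrite yb in le; lia.
  by apply: (W x y z) => //; rewrite (negbTE yw) in le; lia.
Qed.

Lemma w_convex_of_convex_thin X :
  white_convex K X -> black_thin K X -> w_convex K X.
Proof.
move=> wX bX; apply/w_convexP; split; [exact: convex_thin_arc| |by []].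
(* A single black bead is not thin, as both extremes lie outside it. *)
move=> b bb e; have := bb; rewrite blackE => /and3P[_ b0 bn].
have := @black_thin_le X least b greatest bX bb.
rewrite least_le le_greatest e !inE eqxx -!val_eqE /= => h.
by have : false by apply: h => //; lia.
Qed.

Lemma black_thin_of_w_convex X w :
  w_convex K X -> w \in X -> w \notin black K -> black_thin K X.
Proof.
move=> /w_convexP[aX _ wX] wwX ww i j k ijk jb iX kX.
have W i' j' k' := @white_convex_le X i' j' k' wX.
rewrite -(black_between _ _ _ ijk) in jb; apply/negP => jX.
have lo := least_le; have hi := le_greatest.
case: aX => cX.
  (* On the cut necklace [greatest] lies between the white [w] and the black [j]. All beads above
     [j] then follow: the black ones by the interval, the white ones by convexity. *)
  have mX : greatest \in X.
    apply: (cX w greatest j) => //.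
    by rewrite !bead_key_le (negbTE ww) jb (negbTE greatest_white) hi.
  case/negP: kX; have [kb|kw] := boolP (k \in black K).
    by apply: (cX w k j) => //; rewrite !bead_key_le (negbTE ww) jb kb /=; lia.
  by apply: (W j k greatest) => //; rewrite hi; lia.
have cX' x y z : bead_key K x <= bead_key K y <= bead_key K z ->
    x \notin X -> z \notin X -> y \notin X.
  by move=> le xX zX; have := cX x y z le; rewrite !inE; apply.
(* A black [i] would come after [j] on the cut necklace and [k] before it, so [j] would lie in the
   interval outside [X]. *)
have iw : i \notin black K.
  apply/negP=> ib; suff : j \notin X by rewrite jX.
  apply: (cX' k j i) => //.
  by rewrite !bead_key_le jb ib; case: ifP => _ /=; lia.
have oX : least \notin X.
  by apply: contra iX => oX; apply: (W least i j) => //; rewrite lo; lia.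
(* The stretch from [least] to [k] avoids [X], and it contains [w] unless [k] is white and below
   [w]; in that case [k] is caught between [j] and [w]. *)
have [kb|kw] := boolP (k \in black K).
  suff : w \notin X by rewrite wwX.
  apply: (cX' least w k) => //.
  by rewrite !bead_key_le (negbTE ww) (negbTE least_white) kb lo orbT.
have [wk|kw'] := leqP w k.
  suff : w \notin X by rewrite wwX.
  apply: (cX' least w k) => //.
  by rewrite !bead_key_le (negbTE ww) (negbTE least_white) lo wk !orbT.
by case/negP: kX; apply: (W j k w) => //; lia.
Qed.

End Necklace.

(** * Both domains in terms of top sets *)

Section Rankings.

Context {n : nat} {K : {set 'I_n}}.

Definition top_set (v : ranking n) (m : nat) : {set 'I_n} :=
  [set x | (v^-1)%g x < m].

Lemma card_top_set v m : m <= n -> #|top_set v m| = m.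
Proof.
move=> mn; have -> : top_set v m = (v \o widen_ord mn) @: [set: 'I_m].
  apply/setP=> x; rewrite inE; apply/idP/imsetP => [xm|[i _ ->]]; last first.
    by rewrite /= permK /= ltn_ord.
  exists (Ordinal xm); first by rewrite inE.
  by apply: (@perm_inj _ (v^-1)%g); rewrite /= permK; apply: val_inj.
rewrite card_imset ?cardsT ?card_ord //.
by apply: inj_comp perm_inj _ => i j /(congr1 val) e; apply: val_inj.
Qed.

(** By induction on [k], a flag is determined by the order that it defines, which removes the choice
    of the flag from [necklace_domain]. *)
Lemma flag_top_set (X : {ffun 'I_n.+1 -> {set 'I_n}}) v k :
  w_flag K X -> flag_ranking X v -> k <= n -> X (inord k) = top_set v k.
Proof.
move=> /and4P[/eqP X0 _ _ /forallP cX] /forallP fX.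
elim: k => [_|k IH kn].
  have -> : inord 0 = ord0 :> 'I_n.+1 by apply: val_inj; rewrite /= inordK.
  by rewrite X0; apply/setP=> x; rewrite !inE.
have sub : X (inord k) \subset X (inord k.+1).
  have /forallP/(_ (inord k.+1))/implyP := cX (inord k).
  by rewrite !inordK ?ltnS ?(ltnW kn) // => /(_ (ltnSn k))/proper_sub.
have /eqP e := fX (Ordinal kn); move: sub e; rewrite /= IH ?(ltnW kn) // => sub e.
rewrite -[LHS](setID _ (top_set v k)) -e (setIidPr sub).
apply/setP=> x; rewrite in_setU in_set1 !inE.
rewrite -(inj_eq (@perm_inj _ (v^-1)%g)) permK -val_eqE /=; lia.
Qed.

Lemma necklace_domainP v :
  v \in necklace_domain K <->
  (forall m, 0 < m <= n -> w_convex K (top_set v m)).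
Proof.
rewrite inE; split=> [/existsP[X /andP[fX rX]] m /andP[m0 mn]|wv].
  rewrite -(flag_top_set _ _ _ fX rX mn).
  have /and4P[_ _ /forallP/(_ (inord m)) + _] := fX.
  by rewrite inordK ?ltnS // m0 => /andP[].
apply/existsP; exists [ffun k : 'I_n.+1 => top_set v k]; apply/andP; split.
  apply/and4P; split; rewrite ?ffunE.
  - by apply/eqP/setP=> x; rewrite !inE.
  - by apply/eqP/setP=> x; rewrite !inE ltn_ord.
  - apply/forallP=> k; have kn : k <= n by rewrite -ltnS.
    rewrite ffunE card_top_set // eqxx andbT; apply/implyP=> k0.
    by rewrite wv // k0.
  - apply/forallP=> j; apply/forallP=> k; apply/implyP=> jk; rewrite !ffunE.
    have kn : k <= n by rewrite -ltnS.
    have jn : j <= n by rewrite -ltnS.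
    rewrite properEcard !card_top_set // jk andbT.
    by apply/subsetP=> x; rewrite !inE => /leq_trans; apply; apply: ltnW.
apply/forallP=> i; rewrite !ffunE !inordK ?ltnS ?(ltnW (ltn_ord i)) //.
apply/eqP/setP=> x; rewrite !inE -leqNgt ltnS -eqn_leq.
by rewrite -(inj_eq (@perm_inj _ (v^-1)%g)) permK eq_sym.
Qed.

Lemma ranked_lastE v (i j k : 'I_n) : i < j < k ->
  ranked_last v [set i; j; k] j = prefers v i j && prefers v k j.
Proof.
move=> ijk; rewrite /ranked_last !inE eqxx orbT /=.
apply/forall_inP/andP => [h|[ij kj] y].
  by split; apply: h; rewrite !inE eqxx ?orbT andbT -val_eqE /=; lia.
by rewrite !inE => /andP[/negbTE ->]; rewrite orbF => /orP[]/eqP->.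
Qed.

Lemma ranked_firstE v (i j k : 'I_n) : i < j < k ->
  ranked_first v [set i; j; k] j = prefers v j i && prefers v j k.
Proof.
move=> ijk; rewrite /ranked_first !inE eqxx orbT /=.
apply/forall_inP/andP => [h|[ij kj] y].
  by split; apply: h; rewrite !inE eqxx ?orbT andbT -val_eqE /=; lia.
by rewrite !inE => /andP[/negbTE ->]; rewrite orbF => /orP[]/eqP->.
Qed.

(** The bead [j] is last among the three iff some top set contains [i] and [k] without [j], and
    first iff some top set contains [j] without [i] and [k]. *)
Lemma fishburn_domainP v :
  v \in fishburn_domain K <->
  (forall m, white_convex K (top_set v m) /\ black_thin K (top_set v m)).
Proof.
rewrite inE; split=> [/forallP fv m|wb].
  split=> i j k ijk jK; rewrite !inE; have /forallP/(_ j)/forallP/(_ k) := fv i;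
    rewrite ijk ?jK ?(negbTE jK) ?ranked_lastE ?ranked_firstE // /prefers; lia.
apply/forallP=> i; apply/forallP=> j; apply/forallP=> k; apply/implyP=> ijk.
case: ifPn => jK.
  (* Positions count from 0, so this top set stops just above [j]; the one used for a black [j] has
     one more element and ends with [j]. *)
  have [+ _] := wb ((v^-1)%g j) => /(_ i j k ijk jK).
  by rewrite ranked_lastE // /prefers !inE; lia.
have [_ +] := wb ((v^-1)%g j).+1 => /(_ i j k ijk jK).
by rewrite ranked_firstE // /prefers !inE; lia.
Qed.

End Rankings.

Theorem theorem1 (n : nat) (hn : 3 <= n) (K : {set 'I_n}) (hK : K \subset inner n) :
  necklace_domain K = fishburn_domain K.
Proof.
apply/setP=> v; apply/idP/idP.
  move/necklace_domainP => wv; apply/fishburn_domainP => m.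
  (* For [m = 0] and [m > n] the top set is empty or full, and both conditions are trivial. *)
  have [m0|m0] := posnP m.
    have t0 x : (x \in top_set v m) = false by rewrite inE m0.
    by split=> i j k; rewrite !t0.
  have [mn|nm] := leqP m n; last first.
    have tT x : x \in top_set v m by rewrite inE (ltn_trans (ltn_ord _) nm).
    by split=> i j k; rewrite !tT.
  have wm : w_convex K (top_set v m) by apply: wv; rewrite m0.
  split; first by case/(w_convexP hn hK): wm.
  have n0 : 0 < n by lia.
  (* The white bead supplied is the top alternative; were it black, the top set of size 1 would be a
     single black bead. *)
  apply: (black_thin_of_w_convex hn hK _ (v (Ordinal n0)) wm).
    by rewrite inE permK.
  apply/negP=> b0; case/(w_convexP hn hK): (wv 1 n0) => _ /(_ _ b0) + _; apply.
  apply/setP=> x; rewrite !inE -(inj_eq (@perm_inj _ (v^-1)%g)) permK.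
  by rewrite -val_eqE /=; lia.
move/fishburn_domainP => wv; apply/necklace_domainP => m _.
by have [wm bm] := wv m; exact: w_convex_of_convex_thin.
Qed.
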